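(* Let $D$ be an integral domain with quotient field $K$ and let $X$ be an indeterminate over $D$. Then $D$ is a super $v$-domain if and only if $D+XK[X]$ is a super $v$-domain.
   Context: For an integral domain $R$ with quotient field $L$ and a nonzero fractional ideal $A$ of $R$, $A^{-1}=\{x\in L : xA\subseteq R\}$. $R$ is a $v$-domain if $(AA^{-1})^{-1}=R$ for every nonzero finitely generated ideal $A$ of $R$. $R$ is a super $v$-domain if every quotient ring of $R$, i.e. every ring of fractions $R_S$ with $S$ a multiplicative set of $R$ (not containing $0$), is a $v$-domain. $D+XK[X]$ denotes the subring of $K[X]$ consisting of the polynomials whose constant term lies in $D$. *)

(* Defs.v *)
From HB Require Import structures.
From mathcomp Require Import all_boot all_algebra.
From mathcomp Require Import boolp classical_sets.
Set Implicit Arguments.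
Unset Strict Implicit.
Unset Printing Implicit Defensive.
Import GRing.Theory.
Local Open Scope classical_set_scope.
Local Open Scope ring_scope.

Local Notation "x %:F" := (@FracField.tofrac _ x).

(** A subring of an integral domain, as an integral domain in its own right. *)

Section Subdomain.
Variables (T : idomainType) (B : subringClosed T).

Definition subdomain : Type := {x : T | x \in B}.

HB.instance Definition _ := SubChoice.on subdomain.
HB.instance Definition _ := [SubChoice_isSubComNzRing of subdomain by <:].

(* The ambient inverse need not lie in [B], so units are not inherited. *)
Definition subdomain_unit : {pred subdomain} :=
  [pred x | (val x \is a GRing.unit) && ((val x)^-1 \in B)].

Definition subdomain_inv (x : subdomain) : subdomain :=
  if x \in subdomain_unit then insubd x (val x)^-1 else x.

Fact subdomain_mulVx : {in subdomain_unit, left_inverse 1 subdomain_inv *%R}.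
Proof.
move=> x xU; rewrite /subdomain_inv xU; case/andP: xU => xU xB.
by apply: val_inj; rewrite rmorphM rmorph1 /= val_insubd xB mulVr.
Qed.

Fact subdomain_unitPl (x y : subdomain) : y * x = 1 -> subdomain_unit x.
Proof.
move=> /(congr1 val); rewrite rmorphM rmorph1 => yx1.
have xU : val x \is a GRing.unit.
  by apply/unitrP; exists (val y); rewrite [val x * _]mulrC.
apply/andP; split=> //.
by rewrite -[(val x)^-1]mul1r -yx1 mulrK // (valP y).
Qed.

Fact subdomain_inv_out : {in [predC subdomain_unit], subdomain_inv =1 id}.
Proof. by move=> x xU; rewrite /subdomain_inv ifN. Qed.

HB.instance Definition _ := GRing.ComNzRing_hasMulInverse.Build subdomain
  subdomain_mulVx subdomain_unitPl subdomain_inv_out.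

Fact subdomain_integral (x y : subdomain) :
  x * y = 0 -> (x == 0) || (y == 0).
Proof.
move=> /(congr1 val)/eqP; rewrite rmorphM rmorph0 mulf_eq0.
by rewrite -!(inj_eq val_inj) rmorph0.
Qed.

HB.instance Definition _ :=
  GRing.ComUnitRing_isIntegral.Build subdomain subdomain_integral.

End Subdomain.

Section VDomain.
Variable R : idomainType.
Implicit Types A B : set {fraction R}.

Definition ideal_gen (s : seq R) : set R :=
  [set a | exists c : 'I_(size s) -> R, a = \sum_i c i * s`_i].

Definition frac_inv A : set {fraction R} :=
  [set x | forall a, A a -> range (@FracField.tofrac R) (x * a)].

Definition frac_mul A B : set {fraction R} :=
  [set x | exists n (a b : 'I_n -> {fraction R}),
     [/\ forall i, A (a i), forall i, B (b i) & x = \sum_i a i * b i]].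

Definition v_domain : Prop :=
  forall I : set R, (exists s, I = ideal_gen s) -> I <> [set 0] ->
  let A := @FracField.tofrac R @` I in
  frac_inv (frac_mul A (frac_inv A)) = range (@FracField.tofrac R).

End VDomain.

Section Localization.
Variables (R : idomainType) (S : mulrClosed R).

(* If [0] were in [S], the quotients by it would contribute only [0]
   ([x / 0 = 0] in MathComp), so this is a subring without assuming [0 \notin S]. *)
Definition fractions_pred : {pred {fraction R}} :=
  fun x => `[< exists a s, s \in S /\ x = a%:F / s%:F >].

Fact fractions_subring_closed : subring_closed fractions_pred.
Proof.
have inE x : x \in fractions_pred ->
    exists a s, [/\ s \in S, s != 0 & x = a%:F / s%:F].
  move=> /asboolP[a [s [sS ->]]]; have [->|s0] := eqVneq s 0.
    exists 0, 1; split; rewrite ?rpred1 ?oner_eq0 //.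
    by rewrite tofrac0 mul0r invr0 mulr0.
  by exists a, s.
split.
- by apply/asboolP; exists 1, 1; rewrite rpred1 divr1.
- move=> _ _ /inE[a [s [sS s0 ->]]] /inE[b [t [tS t0 ->]]].
  apply/asboolP; exists (a * t - b * s), (s * t); split; first exact: rpredM.
  by rewrite -mulNr addf_div ?tofrac_eq0 // tofracB !tofracM mulNr.
- move=> _ _ /inE[a [s [sS s0 ->]]] /inE[b [t [tS t0 ->]]].
  apply/asboolP; exists (a * b), (s * t); split; first exact: rpredM.
  by rewrite mulf_div !tofracM.
Qed.

HB.instance Definition _ :=
  GRing.isSubringClosed.Build {fraction R} fractions_pred
    fractions_subring_closed.

Definition ring_of_fractions : idomainType := subdomain fractions_pred.

End Localization.

Definition super_v_domain (R : idomainType) : Prop :=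
  forall S : mulrClosed R, 0 \notin S -> v_domain (ring_of_fractions S).

Section DXKX.
Variable D : idomainType.

Definition DXKX_pred : {pred {poly {fraction D}}} :=
  fun p => `[< exists d : D, p`_0 = d%:F >].

Fact DXKX_subring_closed : subring_closed DXKX_pred.
Proof.
split.
- by apply/asboolP; exists 1; rewrite coef1.
- move=> p q /asboolP[a pa] /asboolP[b qb]; apply/asboolP; exists (a - b).
  by rewrite coefB pa qb tofracB.
- move=> p q /asboolP[a pa] /asboolP[b qb]; apply/asboolP; exists (a * b).
  by rewrite coef0M pa qb tofracM.
Qed.

HB.instance Definition _ :=
  GRing.isSubringClosed.Build {poly {fraction D}} DXKX_pred
    DXKX_subring_closed.

Definition DXKX : idomainType := subdomain DXKX_pred.

End DXKX.

(* Main.v *)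
Require Import Defs.
From HB Require Import structures.
From mathcomp Require Import all_boot all_algebra.
From mathcomp Require Import boolp classical_sets.
From mathcomp Require Import ring.
Set Implicit Arguments.
Unset Strict Implicit.
Unset Printing Implicit Defensive.
Import GRing.Theory.
Local Open Scope classical_set_scope.
Local Open Scope ring_scope.

Local Notation "x %:F" := (@FracField.tofrac _ x).

(** Write K for the quotient field of D and T for D + X K[X].

    A domain R with quotient field L is a v-domain exactly when, for every
    nonzero finitely generated fractional ideal I and every x in L, the
    inclusion x I^-1 <= I^-1 forces x in R: indeed x lies in (I I^-1)^-1 iff
    x I^-1 I <= R iff x I^-1 <= I^-1.  In this form ([v_closed], shown
    equivalent in [v_domainP]) the condition speaks only of elements of L, so
    all rings of fractions of D are compared inside K, and all those of T
    inside one field that contains K[X].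

    Let S be a multiplicative set of T.  If some f in S has zero constant term,
    then every p in K[X] equals p f / f with p f in T, so T_S contains K[X] and
    is a localization of K[X].  It is then a principal ideal domain, hence a
    v-domain, whatever D is ([v_closed_meetsX]).

    Otherwise the constant terms of S form a multiplicative set S0 of D, and
    T_S consists of the fractions p/t, with p in K[X] and t in S, whose value
    p(0)/t(0) at 0 lies in D_S0 ([fraction_set_pullback]).  Thus T_S is the
    pullback of D_S0 along the evaluation at 0 of the localization B of K[X] at
    S.  Since K[X] is principal, a nonzero finitely generated fractional ideal
    of T_S may be rescaled so that its generators q_i are polynomials with
    1 as a K[X]-combination ([coprime_form]).  Their constant terms generate a
    nonzero fractional ideal J of D_S0, and each k in J^-1 <= K lies in I^-1.
    If x I^-1 <= I^-1, then x k q_i lies in T_S <= B for every i and each such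
    k; taking k nonzero shows that x lies in B, and then x(0) J^-1 <= J^-1.  So x(0) lies in D_S0 when D_S0 is a v-domain, and
    then x lies in T_S ([v_closed_pullback]).

    Conversely, a multiplicative set S of D is the set of constant terms of the
    same set seen as constants of T, and an ideal of D_S can be tested in T_S:
    the inverse of its extension consists of p/t such that p(0)/t(0) is in the
    inverse of the original ideal ([v_closed_of_pullback]). *)

(** * Fractions and common denominators *)

Lemma frac_tofracP (R : idomainType) (x : {fraction R}) :
  exists p q : R, q != 0 /\ x = p%:F / q%:F.
Proof.
elim/quotW: x => r; exists r.1, r.2; split; first exact: denom_ratioP.
have d0 := denom_ratioP r.
apply: (@mulIf _ (r.2)%:F); first by rewrite tofrac_eq0.
rewrite divfK ?tofrac_eq0 // /FracField.tofrac; unlock.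
rewrite -[LHS]FracField.pi_mul; apply/eqmodP; rewrite /= FracField.equivfE.
rewrite /FracField.mulf !numden_Ratio ?mulf_neq0 ?oner_neq0 //.
by rewrite !mulr1 mulrC.
Qed.

Lemma ideal_gen_mem (R : idomainType) (s : seq R) a : a \in s -> ideal_gen s a.
Proof.
move=> sa; have lts : (index a s < size s)%N by rewrite index_mem.
exists (fun i => (i == Ordinal lts)%:R).
rewrite (bigD1 (Ordinal lts)) //= eqxx mul1r nth_index //.
by rewrite big1 ?addr0 // => i /negPf ->; rewrite mul0r.
Qed.

(** * The v-property tested inside a field *)

Section VClosed.
Variable L : fieldType.

(** This is (I^-1 : I^-1) = B for the fractional ideals I generated by finite
    families s: y ranges over I^-1.  The families have entries in L rather than
    in B, so that ideals may be rescaled freely. *)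
Definition v_closed (B : set L) := forall s : seq L,
  (exists2 a, a \in s & a != 0) -> forall x,
  (forall y, {in s, forall a, B (y * a)} -> {in s, forall a, B (x * y * a)}) ->
  B x.

Variables (R : idomainType) (f : {rmorphism R -> L}).
Hypothesis f_inj : injective f.
Hypothesis f_frac : forall x, exists p q, q != 0 /\ x = f p / f q.

Lemma common_denominator (s : seq L) :
  exists2 d, d != 0 & exists r, s = [seq f p / f d | p <- r].
Proof.
have fd0 d : d != 0 -> f d != 0 by rewrite -(inj_eq f_inj) rmorph0.
elim: s => [|x s [d d0 [r ->]]]; first by exists 1; [exact: oner_neq0|exists [::]].
have [p [q [q0 ->]]] := f_frac x.
exists (q * d); first by rewrite mulf_neq0.
exists (p * d :: [seq t * q | t <- r]); rewrite /= -map_comp; congr (_ :: _).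
  by rewrite !rmorphM /= -mulf_div divff ?mulr1 ?fd0.
apply: eq_map => t /=.
by rewrite !rmorphM /= [f q * _]mulrC -mulf_div divff ?mulr1 ?fd0.
Qed.

Lemma tofrac_rangeE (p q : R) : q != 0 ->
  range (@FracField.tofrac R) (p%:F / q%:F) <-> range f (f p / f q).
Proof.
move=> q0; have qF0 : q%:F != 0 by rewrite tofrac_eq0.
have fq0 : f q != 0 by rewrite -(inj_eq f_inj) rmorph0 in q0.
split=> -[r _ e]; exists r => //.
- have /eqP := congr1 ( *%R^~ q%:F) e.
  rewrite divfK // -tofracM tofrac_eq => /eqP <-.
  by rewrite rmorphM mulfK.
- have := congr1 ( *%R^~ (f q)) e.
  by rewrite divfK // -rmorphM => /f_inj <-; rewrite tofracM mulfK.
Qed.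

(** The two sides differ by a choice of field of fractions and by a common
    denominator: multiplying the generators by d divides the inverse ideal by d,
    which leaves the set of x that preserve it unchanged. *)
Lemma v_domainP : v_domain R <-> v_closed (range f).
Proof.
pose rF : set {fraction R} := range (@FracField.tofrac R).
have rF0 : rF 0 by exists 0; rewrite ?tofrac0.
have rFD x y : rF x -> rF y -> rF (x + y).
  by move=> [r _ <-] [t _ <-]; exists (r + t); rewrite ?tofracD.
have rFM r x : rF x -> rF (r%:F * x).
  by move=> [t _ <-]; exists (r * t); rewrite ?tofracM.
(* An element lies in the inverse of an ideal as soon as it multiplies the
   generators into the ring. *)
have gen s y : {in s, forall a, rF (y * a%:F)} ->
    forall a, ideal_gen s a -> rF (y * a%:F).
  move=> ys a [c ->]; rewrite rmorph_sum mulr_sumr.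
  elim/big_ind: _ => // i _; rewrite rmorphM mulrCA; apply: rFM.
  exact/ys/mem_nth.
split=> [Rv s [a0 a0s a00] x xP | fv I [s ->] I0 A].
- have [d d0 [r sE]] := common_denominator s.
  have fd0 : f d != 0 by rewrite -(inj_eq f_inj) rmorph0 in d0.
  have [p [q [q0 xE]]] := f_frac x.
  rewrite xE; apply/tofrac_rangeE => //.
  have I0 : ideal_gen r <> [set 0].
    move: a0s; rewrite sE => /mapP[t tr a0E] rI0.
    have := ideal_gen_mem tr.
    by rewrite rI0 /= => t0; rewrite a0E t0 rmorph0 mul0r eqxx in a00.
  suff : frac_inv (frac_mul (@FracField.tofrac R @` ideal_gen r)
          (frac_inv (@FracField.tofrac R @` ideal_gen r))) (p%:F / q%:F).
    by rewrite (Rv _ _ I0) //; exists r.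
  move=> z [n [a [b [aA bA ->]]]]; rewrite mulr_sumr.
  elim/big_ind: _ => // i _; have [t It <-] := aA i.
  rewrite mulrCA mulrC; apply: gen It => t' t'r.
  have [u [v [v0 bE]]] := frac_tofracP (b i).
  rewrite bE mulf_div -!tofracM mulrAC -tofracM.
  apply/tofrac_rangeE; first by rewrite mulf_neq0.
  have -> : f (p * u * t') / f (q * v) = x * (f u / f v * f d) * (f t' / f d).
    have fq0 : f q != 0 by rewrite -(inj_eq f_inj) rmorph0 in q0.
    have fv0 : f v != 0 by rewrite -(inj_eq f_inj) rmorph0 in v0.
    by rewrite xE !rmorphM /=; field; rewrite fv0 fq0 fd0.
  apply: xP; last by rewrite sE; apply/mapP; exists t'.
  rewrite sE => _ /mapP[w wr ->].
  have -> : f u / f v * f d * (f w / f d) = f (u * w) / f v.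
    have fv0 : f v != 0 by rewrite -(inj_eq f_inj) rmorph0 in v0.
    by rewrite rmorphM /=; field; rewrite fv0 fd0.
  apply/tofrac_rangeE => //; rewrite tofracM mulrAC -bE; apply: bA.
  by exists w => //; exact: ideal_gen_mem.
- rewrite eqEsubset; split=> [x xA | _ [r _ <-] z [n [a [b [aA bA ->]]]]].
  + have [p [q [q0 xE]]] := frac_tofracP x.
    have fq0 : f q != 0 by rewrite -(inj_eq f_inj) rmorph0 in q0.
    rewrite xE; apply/tofrac_rangeE => //; apply: (fv [seq f a | a <- s]).
      have [[a as_ a0]|s0] := pselect (exists2 a, a \in s & a != 0).
        by exists (f a); [exact: map_f | rewrite -(inj_eq f_inj) rmorph0 in a0].
      case: I0; rewrite eqEsubset; split=> [a [c ->]|_ ->]; last first.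
        exists (fun=> 0); rewrite big1 // => i _; exact: mul0r.
      rewrite /= big1 // => i _; have [->|si0] := eqVneq s`_i 0.
        by rewrite mulr0.
      by case: s0; exists s`_i => //; exact: mem_nth.
    move=> y yP _ /mapP[t ts ->]; have [u [v [v0 yE]]] := f_frac y.
    have fv0 : f v != 0 by rewrite -(inj_eq f_inj) rmorph0 in v0.
    have -> : f p / f q * y * f t = f (p * u * t) / f (q * v).
      by rewrite yE !rmorphM /=; field; rewrite fv0 fq0.
    apply/tofrac_rangeE; first by rewrite mulf_neq0.
    have -> : (p * u * t)%:F / (q * v)%:F = x * (t%:F * (u%:F / v%:F)).
      by rewrite xE [t%:F * _]mulrA mulf_div -!tofracM [t * u]mulrC mulrA.
    apply: xA; exists 1, (fun=> t%:F), (fun=> u%:F / v%:F); split.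
    * by move=> _; exists t => //; exact: ideal_gen_mem.
    * move=> _ _ [t' It' <-]; apply: gen It' => w ws.
      rewrite mulrAC -tofracM; apply/tofrac_rangeE => //.
      by rewrite rmorphM /= mulrAC -yE; apply/yP/map_f.
    * by rewrite big_ord1.
  + rewrite mulr_sumr; elim/big_ind: _ => // i _.
    by apply: rFM; rewrite mulrC; exact: bA.
Qed.
End VClosed.

(** * Rings of fractions as subsets of the quotient field *)

Section RingOfFractions.
Variables (R : idomainType) (S : mulrClosed R).

Definition fraction_set : set {fraction R} := [set x | x \in fractions_pred S].

Lemma fraction_setP : 0 \notin S -> forall x, fraction_set x <->
  exists a s, [/\ s \in S, s != 0 & x = a%:F / s%:F].
Proof.
move=> S0 x; split=> [/asboolP[a [s [sS ->]]]|[a [s [sS _ ->]]]].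
  by exists a, s; split=> //; apply: contraNneq S0 => <-.
by apply/asboolP; exists a, s.
Qed.

Lemma fraction_set_tofrac a : fraction_set a%:F.
Proof. by apply/asboolP; exists a, 1; rewrite rpred1 tofrac1 divr1. Qed.

(** The quotient field of R is also a quotient field of R_S, so the ring R_S can
    be studied without forming the quotient field of R_S itself. *)
Lemma v_domain_fractionsP :
  v_domain (ring_of_fractions S) <-> v_closed fraction_set.
Proof.
have frac x : exists p q : ring_of_fractions S, q != 0 /\ x = val p / val q.
  have [a [b [b0 ->]]] := frac_tofracP x.
  exists (Sub a%:F (fraction_set_tofrac a)), (Sub b%:F (fraction_set_tofrac b)).
  by rewrite -(inj_eq val_inj) rmorph0 !SubK tofrac_eq0.
have := v_domainP (f := \val : {rmorphism ring_of_fractions S -> _}) val_inj frac.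
suff -> : range (val : ring_of_fractions S -> {fraction R}) = fraction_set by [].
rewrite eqEsubset; split=> [_ [x _ <-]|x xS]; first exact: valP.
by exists (Sub x xS); rewrite ?SubK.
Qed.
End RingOfFractions.

(** * Polynomial lemmas *)

Lemma bezout_seq (K : fieldType) (s : seq {poly K}) :
  exists g, {in s, forall p, g %| p} /\
    exists u : nat -> {poly K}, g = \sum_(i < size s) u i * s`_i.
Proof.
elim: s => [|p s [g [gs [u gE]]]].
  by exists 0; split=> //; exists (fun=> 0); rewrite big_ord0.
have [[v w] /= vwE] := Bezoutp p g.
exists (v * p + w * g); split.
  move=> q; rewrite (eqp_dvdl _ vwE) inE => /orP[/eqP->|/gs]; first exact: dvdp_gcdl.
  exact/dvdp_trans/dvdp_gcdr.
exists (fun i => if i is j.+1 then w * u j else v).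
rewrite big_ord_recl /= gE mulr_sumr; congr (_ + _).
by apply: eq_bigr => i _; rewrite mulrA.
Qed.

Lemma mul_divAC (F : fieldType) (a b c d : F) : a * b * c / d = a * (b / d) * c.
Proof. by rewrite mulrAC mulrA. Qed.

Lemma coef0_scale (R : nzRingType) (a b : R) (p : {poly R}) :
  (a%:P * p * b%:P)`_0 = a * p`_0 * b.
Proof. by rewrite !coef0M !coefC. Qed.

(** * The field of fractions of D + X K[X] contains K[X] *)

Section PolyFrac.
Variable D : idomainType.
Local Notation K := {fraction D}.
Local Notation T := (DXKX D).
Local Notation L := {fraction T}.

Lemma DXKXP (p : {poly K}) : reflect (exists d : D, p`_0 = d%:F) (p \in @DXKX_pred D).
Proof. exact: asboolP. Qed.

(** The inclusion of T in K[X], named so that it carries a ring morphism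
    structure with target K[X] itself. *)
Definition to_poly (t : T) : {poly K} := val t.

Fact to_poly_is_zmod_morphism : zmod_morphism to_poly.
Proof. by []. Qed.

Fact to_poly_is_monoid_morphism : monoid_morphism to_poly.
Proof. by []. Qed.

HB.instance Definition _ :=
  GRing.isZmodMorphism.Build T {poly K} to_poly to_poly_is_zmod_morphism.
HB.instance Definition _ :=
  GRing.isMonoidMorphism.Build T {poly K} to_poly to_poly_is_monoid_morphism.

Lemma to_poly_inj : injective to_poly. Proof. exact: val_inj. Qed.

Lemma to_poly_eq0 t : (to_poly t == 0) = (t == 0).
Proof. by rewrite -(inj_eq to_poly_inj) rmorph0. Qed.

Lemma to_polyP (p : {poly K}) :
  (exists t, to_poly t = p) <-> exists d : D, p`_0 = d%:F.
Proof.
split=> [[t <-]|pD]; first exact/DXKXP/(valP t).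
by exists (Sub p (introT (DXKXP p) pD)); rewrite /to_poly SubK.
Qed.

Lemma coef0_to_poly t : exists d : D, (to_poly t)`_0 = d%:F.
Proof. by apply/to_polyP; exists t. Qed.

Fact mulX_subproof (p : {poly K}) : 'X * p \in @DXKX_pred D.
Proof. by apply/DXKXP; exists 0; rewrite coefXM tofrac0. Qed.

Definition mulX (p : {poly K}) : T := Sub ('X * p) (mulX_subproof p).

Lemma to_poly_mulX p : to_poly (mulX p) = 'X * p. Proof. exact: SubK. Qed.

(** Although p need not be in T, both X p and X are, and their quotient is p:
    this embeds K[X] in the quotient field of T. *)
Definition poly_frac (p : {poly K}) : L := (mulX p)%:F / (mulX 1)%:F.

Lemma mulX1_neq0 : (mulX 1)%:F != 0.
Proof. by rewrite tofrac_eq0 -to_poly_eq0 to_poly_mulX mulr1 polyX_eq0. Qed.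

Fact poly_frac_is_zmod_morphism : zmod_morphism poly_frac.
Proof.
move=> p q; rewrite /poly_frac -mulrBl -tofracB; congr (_%:F / _).
by apply: to_poly_inj; rewrite rmorphB /= !to_poly_mulX mulrBr.
Qed.

Fact poly_frac_is_monoid_morphism : monoid_morphism poly_frac.
Proof.
split=> [|p q]; first by rewrite /poly_frac divff // mulX1_neq0.
apply: (mulIf (mulf_neq0 mulX1_neq0 mulX1_neq0)).
rewrite /poly_frac mulrA divfK ?mulX1_neq0 // mulrACA !divfK ?mulX1_neq0 //.
rewrite -!tofracM; congr (_%:F); apply: to_poly_inj.
by rewrite !rmorphM /= !to_poly_mulX mulr1 mulrAC mulrACA mulrA.
Qed.

HB.instance Definition _ :=
  GRing.isZmodMorphism.Build {poly K} L poly_frac poly_frac_is_zmod_morphism.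
HB.instance Definition _ :=
  GRing.isMonoidMorphism.Build {poly K} L poly_frac poly_frac_is_monoid_morphism.

Lemma poly_frac_inj : injective poly_frac.
Proof.
apply: raddf_inj => p /eqP; rewrite mulf_eq0 invr_eq0 (negPf mulX1_neq0) orbF.
by rewrite tofrac_eq0 -to_poly_eq0 to_poly_mulX mulf_eq0 polyX_eq0 => /eqP.
Qed.

Lemma poly_frac_eq0 p : (poly_frac p == 0) = (p == 0).
Proof. by rewrite -(inj_eq poly_frac_inj) rmorph0. Qed.

Lemma poly_frac_to_poly (t : T) : poly_frac (to_poly t) = t%:F.
Proof.
apply: (canLR (mulfK mulX1_neq0)); rewrite -tofracM; congr (_%:F).
by apply: to_poly_inj; rewrite rmorphM /= !to_poly_mulX mulr1 mulrC.
Qed.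

(** Clear denominators to get polynomials, then divide them by their gcd g:
    a Bezout relation for g becomes one for 1. *)
Lemma coprime_form (s : seq L) : (exists2 a, a \in s & a != 0) ->
  exists2 c, c != 0 & exists q : seq {poly K},
    s = [seq c * poly_frac p | p <- q] /\
    exists u : nat -> {poly K}, 1 = \sum_(i < size q) u i * q`_i.
Proof.
move=> [a]; have [|d d0 [r ->]] :=
  common_denominator (f := @FracField.tofrac T) _ (@frac_tofracP T) s.
  by move=> x y /eqP; rewrite tofrac_eq => /eqP.
move=> /mapP[p pr ->] p0.
have [g [gr [u gE]]] := bezout_seq [seq to_poly t | t <- r].
have g0 : g != 0.
  apply: contraNneq p0 => g0; have := gr _ (map_f _ pr).
  by rewrite g0 dvd0p to_poly_eq0 => /eqP ->;
    rewrite rmorph0 mul0r.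
have gK t : t \in r -> to_poly t %/ g * g = to_poly t by move=> tr; apply/divpK/gr/map_f.
exists (poly_frac g / d%:F).
  by rewrite mulf_neq0 ?poly_frac_eq0 ?invr_eq0 ?tofrac_eq0.
exists [seq to_poly t %/ g | t <- r]; split.
  rewrite -map_comp; apply/eq_in_map => t tr /=.
  by rewrite mulrAC -rmorphM /= [g * _]mulrC gK // poly_frac_to_poly.
exists u; apply: (mulIf g0); rewrite mul1r {1}gE mulr_suml !size_map.
apply: eq_bigr => i _; rewrite -mulrA (nth_map 0) // (nth_map 0) //.
by rewrite gK ?mem_nth.
Qed.

(** * Multiplicative sets containing a multiple of X *)

(** Here T_S contains K[X], as p = p f / f with p f in T.  After rescaling, the
    ideal contains a Bezout combination equal to 1 and its inverse contains 1,
    so x itself is a combination of elements of T_S. *)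
Lemma v_closed_meetsX (S : mulrClosed T) (f : T) :
  f \in S -> f != 0 -> (to_poly f)`_0 = 0 -> v_closed (fraction_set S).
Proof.
move=> fS f0 fX.
have KX p : poly_frac p \in fractions_pred S.
  have [|a aE] := (to_polyP (p * to_poly f)).2.
    by exists 0; rewrite coef0M fX mulr0 rmorph0.
  apply/asboolP; exists a, f; split=> //.
  by rewrite -!poly_frac_to_poly aE rmorphM /= mulfK // poly_frac_to_poly tofrac_eq0.
move=> s /coprime_form[c c0 [q [-> [u uE]]]] x xP.
have {}xP p : p \in q -> x * poly_frac p \in fractions_pred S.
  move=> pq; have := xP c^-1 _ (c * poly_frac p) (map_f _ pq).
  rewrite mulrA divfK //; apply => _ /mapP[p' _ ->].
  by rewrite mulKf //; apply: KX.
rewrite /fraction_set /= -[x]mulr1 -(rmorph1 poly_frac) uE rmorph_sum mulr_sumr.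
apply: rpred_sum => i _; rewrite rmorphM /= mulrCA.
by apply: rpredM; [exact: KX | apply/xP/mem_nth].
Qed.

(** * Multiplicative sets with nonzero constant terms *)

Section Pullback.
Variables (S : mulrClosed T) (S0 : mulrClosed D).
Hypothesis S0_neq0 : 0 \notin S0.
Hypothesis coef0_S : forall t, t \in S ->
  exists2 d, d \in S0 & (to_poly t)`_0 = d%:F.
Hypothesis S_onto : forall d, d \in S0 ->
  exists2 t, t \in S & (to_poly t)`_0 = d%:F.

Lemma coef0_neq0 t : t \in S -> (to_poly t)`_0 != 0.
Proof.
move=> /coef0_S[d dS ->]; rewrite tofrac_eq0.
by apply: contraNneq S0_neq0 => <-.
Qed.

Lemma S_neq0 t : t \in S -> t != 0.
Proof.
move=> /coef0_neq0; apply: contraNneq => ->.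
by rewrite rmorph0 coef0.
Qed.

Lemma zero_notin_S : 0 \notin S.
Proof. by apply/negP => /S_neq0; rewrite eqxx. Qed.

(** If p/t = a/b with a in T and b in S, compare the constant terms of
    p b = a t.  Conversely, if p(0)/t(0) = c/d with d in S0, choose b in S with
    b(0) = d: then p b has constant term c t(0), so p b is in T and
    p/t = p b / (t b). *)
Lemma fraction_set_pullback p t : t \in S ->
  fraction_set S (poly_frac p / t%:F) <->
  fraction_set S0 (p`_0 / (to_poly t)`_0).
Proof.
move=> tS; have t0 := coef0_neq0 tS; have tn0 := S_neq0 tS.
have tF0 : t%:F != 0 by rewrite tofrac_eq0.
split=> [/(fraction_setP zero_notin_S)[a [b [bS b0]]]|].
- move/eqP; have bF0 : b%:F != 0 by rewrite tofrac_eq0.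
  rewrite (@eqr_div L _ _ _ _ tF0 bF0).
  rewrite -(poly_frac_to_poly b) -(poly_frac_to_poly t) -(poly_frac_to_poly a).
  rewrite -(rmorphM poly_frac p) -(rmorphM poly_frac (to_poly a)) /=.
  rewrite (inj_eq poly_frac_inj) => /eqP /(congr1 (fun q : {poly K} => q`_0)).
  rewrite !coef0M; have [d dS bE] := coef0_S bS; have [c ->] := coef0_to_poly a.
  move=> e; apply/(fraction_setP S0_neq0); exists c, d.
  have d0 : d != 0 by apply: contraNneq S0_neq0 => <-.
  by split=> //; apply/eqP; rewrite eqr_div ?tofrac_eq0 // -bE e.
- move=> /(fraction_setP S0_neq0)[c [d [dS d0 /eqP]]].
  rewrite eqr_div ?tofrac_eq0 // => /eqP e.
  have [b bS bE] := S_onto dS.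
  have [g gE] := coef0_to_poly t.
  have [|a aE] := (to_polyP (p * to_poly b)).2.
    by exists (c * g); rewrite coef0M bE e gE tofracM.
  apply/(fraction_setP zero_notin_S); exists a, (t * b).
  rewrite rpredM // mulf_neq0 ?S_neq0 //; split=> //.
  rewrite tofracM -(poly_frac_to_poly a) aE rmorphM /= poly_frac_to_poly.
  have bF0 : b%:F != 0 by rewrite tofrac_eq0 S_neq0.
  by rewrite -mulf_div (divff bF0) mulr1.
Qed.

Lemma fraction_set_poly p : fraction_set S (poly_frac p) <-> fraction_set S0 p`_0.
Proof.
have := fraction_set_pullback p (rpred1 S).
by rewrite tofrac1 rmorph1 coef1 !divr1.
Qed.

(** A y in the inverse of the extended ideal is some p/t, since the ideal
    contains a nonzero constant a and y a is in T_S.  Multiplication by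
    constants acts on p(0)/t(0) as on p/t, so the hypothesis on x in K
    passes to T_S. *)
Lemma v_closed_of_pullback :
  v_closed (fraction_set S) -> v_closed (fraction_set S0).
Proof.
move=> Sv s [a as_ a0] x xP.
have -> : x = x%:P`_0 by rewrite coefC.
apply/fraction_set_poly.
apply: (Sv [seq poly_frac b%:P | b <- s]).
  exists (poly_frac a%:P); first exact: (map_f (fun b => poly_frac b%:P)).
  by rewrite poly_frac_eq0 polyC_eq0.
move=> y yP _ /mapP[b bs ->].
have aP0 : poly_frac a%:P != 0 by rewrite poly_frac_eq0 polyC_eq0.
(* y = (y a) a^-1, where y a is in T_S and a^-1 is a constant of K[X]. *)
have [t tS [p yE]] : exists2 t, t \in S & exists p, y = poly_frac p / t%:F.
  have /(fraction_setP zero_notin_S)[c [t [tS t0]]] :=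
    yP _ (map_f (fun b => poly_frac b%:P) as_).
  move=> /(canRL (mulfK aP0)) ->.
  exists t => //; exists (to_poly c * (a^-1)%:P).
  rewrite rmorphM /= poly_frac_to_poly mulrAC; congr (_ * _ * _).
  apply: (mulIf aP0); rewrite mulVf // -rmorphM /= -polyCM mulVf //.
  by rewrite rmorph1.
have coefE z w : (z%:P * p * w%:P)`_0 / (to_poly t)`_0
    = z * (p`_0 / (to_poly t)`_0) * w.
  by rewrite coef0_scale; exact: mul_divAC.
have fracE z w : poly_frac z%:P * y * poly_frac w%:P
    = poly_frac (z%:P * p * w%:P) / t%:F.
  by rewrite yE !rmorphM /=; apply/esym; exact: mul_divAC.
rewrite fracE; apply/fraction_set_pullback => //; rewrite coefE.
apply: xP bs => b' b's; rewrite -[_ / _]mul1r -coefE.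
apply/fraction_set_pullback => //; rewrite -fracE rmorph1 mul1r.
exact/yP/(map_f (fun b => poly_frac b%:P)).
Qed.

(** With generators q_i whose Bezout combination is 1, every constant k that
    multiplies all q_i(0) into D_S0 is in the inverse ideal.  One nonzero such k
    shows that x is a fraction p/t with t in S; using all of them shows that p(0)/t(0)
    preserves the inverse of the ideal generated by the q_i(0). *)
Lemma v_closed_pullback :
  v_closed (fraction_set S0) -> v_closed (fraction_set S).
Proof.
move=> S0v s /coprime_form[c c0 [q [-> [u uE]]]] x xP.
have {}xP k : {in q, forall p : {poly K}, fraction_set S0 (k * p`_0)} ->
    {in q, forall p, fraction_set S (x * poly_frac (k%:P * p))}.
  move=> kP p pq; have := xP (c^-1 * poly_frac k%:P) _ (c * poly_frac p) (map_f _ pq).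
  have cE p' : c^-1 * poly_frac k%:P * (c * poly_frac p') = poly_frac (k%:P * p').
    by rewrite mulrACA mulVf // mul1r rmorphM.
  rewrite -mulrA cE; apply=> _ /mapP[p' p'q ->]; rewrite cE.
  by apply/fraction_set_poly; rewrite coef0M coefC; apply: kP.
(* A common denominator d of the q_i(0) serves as the nonzero constant. *)
have [d d0 [r rE]] : exists2 d : D, d != 0 & exists r : seq D,
    [seq p`_0 | p : {poly K} <- q] = [seq e%:F / d%:F | e <- r].
  apply: (common_denominator (f := @FracField.tofrac D)).
    by move=> y z /eqP; rewrite tofrac_eq => /eqP.
  exact: frac_tofracP.
have dF0 : d%:F != 0 by rewrite tofrac_eq0.
have dP : {in q, forall p : {poly K}, fraction_set S0 (d%:F * p`_0)}.
  move=> p pq; have := map_f (fun p : {poly K} => p`_0) pq.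
  rewrite rE => /mapP[e _ ->]; rewrite mulrC divfK //.
  exact: fraction_set_tofrac.
have [t tS [p xE]] : exists2 t, t \in S & exists p, x = poly_frac p / t%:F.
  (* x = sum_i (u_i / d) (x d q_i), where each x d q_i is in T_S. *)
  have -> : x = \sum_(i < size q)
      poly_frac ((d%:F)^-1%:P * u i) * (x * poly_frac ((d%:F)%:P * q`_i)).
    rewrite -[LHS]mulr1 -(rmorph1 poly_frac) uE rmorph_sum mulr_sumr.
    apply: eq_bigr => i _; rewrite [RHS]mulrCA -rmorphM /= mulrACA -polyCM.
    by rewrite mulVf // mul1r.
  elim/big_ind: _ => [|_ _ [t tS [p ->]] [t' t'S [p' ->]]|i _].
  - by exists 1; [exact: rpred1 | exists 0; rewrite rmorph0 mul0r].
  - exists (t * t'); first exact: rpredM.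
    exists (p * to_poly t' + p' * to_poly t).
    rewrite addf_div ?tofrac_eq0 ?S_neq0 // tofracM rmorphD !rmorphM /=.
    by rewrite !poly_frac_to_poly.
  - have /(fraction_setP zero_notin_S)[a [b [bS _ ->]]] :=
      xP _ dP _ (mem_nth 0 (ltn_ord i)).
    exists b => //; exists ((d%:F)^-1%:P * u i * to_poly a).
    by rewrite mulrA [in RHS]rmorphM /= poly_frac_to_poly.
rewrite xE; apply/fraction_set_pullback => //.
apply: (S0v [seq p`_0 | p : {poly K} <- q]).
  have [//|] :=
    pselect (exists2 a, a \in [seq p`_0 | p : {poly K} <- q] & a != 0).
  (* If all q_i(0) vanished, so would the constant term of sum_i u_i q_i = 1. *)
  move=> q0; have /eqP : (1 : {poly K})`_0 != 0 by rewrite coef1 oner_neq0.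
  case; rewrite uE coef_sum big1 // => i _; rewrite coef0M.
  have [->|qi0] := eqVneq (q`_i)`_0 0; first by rewrite mulr0.
  case: q0; exists (q`_i)`_0 => //.
  by apply: (map_f (fun p : {poly K} => p`_0)); apply: mem_nth.
move=> k kP _ /mapP[p' p'q ->].
have -> : p`_0 / (to_poly t)`_0 * k * p'`_0
    = (p * (k%:P * p'))`_0 / (to_poly t)`_0.
  by rewrite !coef0M coefC /= -[LHS]mulrA; exact: mulrAC.
apply/fraction_set_pullback => //.
rewrite rmorphM /= mulrAC -xE; apply: xP p'q => p'' p''q.
exact/kP/(map_f (fun p : {poly K} => p`_0)).
Qed.
End Pullback.

(** * Constant terms and constants as multiplicative sets *)

Section MulrClosed.
Definition coef0_image (S : mulrClosed T) : {pred D} :=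
  fun d => `[< exists2 t, t \in S & (to_poly t)`_0 = d%:F >].

Fact coef0_image_mulr_closed S : mulr_closed (coef0_image S).
Proof.
split=> [|c d /asboolP[s sS sE] /asboolP[t tS tE]]; apply/asboolP.
  by exists 1; [exact: rpred1 | rewrite rmorph1 coef1 tofrac1].
by exists (s * t); [exact: rpredM | rewrite rmorphM coef0M sE tE tofracM].
Qed.

HB.instance Definition _ S :=
  GRing.isMulClosed.Build D (coef0_image S) (coef0_image_mulr_closed S).

Definition constants (S : mulrClosed D) : {pred T} :=
  fun t => `[< exists2 d, d \in S & to_poly t = d%:F%:P >].

Fact constants_mulr_closed S : mulr_closed (constants S).
Proof.
split=> [|s t /asboolP[c cS cE] /asboolP[d dS dE]]; apply/asboolP.
  by exists 1; [exact: rpred1 | rewrite rmorph1 tofrac1].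
by exists (c * d); [exact: rpredM | rewrite rmorphM /= cE dE tofracM polyCM].
Qed.

HB.instance Definition _ S :=
  GRing.isMulClosed.Build T (constants S) (constants_mulr_closed S).
End MulrClosed.
End PolyFrac.

(** * The equivalence *)

Theorem theorem0p4 (D : idomainType) :
  super_v_domain D <-> super_v_domain (DXKX D).
Proof.
split=> [Dv S S0 | Tv S S0]; apply/v_domain_fractionsP.
- have [[f fS fX]|SX] := pselect (exists2 f, f \in S & (to_poly f)`_0 = 0).
    apply: (v_closed_meetsX fS _ fX).
    by apply/eqP => f0; move: S0; rewrite -f0 fS.
  have C0 : 0 \notin coef0_image S.
    apply/negP => /asboolP[f fS fX]; apply: SX.
    by exists f => //; rewrite fX tofrac0.
  apply: (v_closed_pullback C0).
  + move=> t tS; have [d dE] := coef0_to_poly t.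
    by exists d => //; apply/asboolP; exists t.
  + by move=> d /asboolP.
  + exact/v_domain_fractionsP/Dv.
- have CP t : t \in constants S -> exists2 d, d \in S & (to_poly t)`_0 = d%:F.
    by move=> /asboolP[d dS tE]; exists d => //; rewrite tE coefC.
  have CS d : d \in S -> exists2 t, t \in constants S & (to_poly t)`_0 = d%:F.
    move=> dS; have [|t tE] := (to_polyP (d%:F%:P)).2; first by exists d; rewrite coefC.
    exists t; last by rewrite tE coefC.
    by apply/asboolP; exists d.
  apply: (v_closed_of_pullback S0 CP CS).
  apply/v_domain_fractionsP/Tv; exact: (zero_notin_S S0 CP).
Qed.
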